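(* Let $P_0$ and $R_0$ be non-isomorphic posets, each of size $m$, let $i\ge 1$, and let $P_iR_i$ be as defined below. Then no witness of $D_{i+m+1}(P_iR_i)$ has size less than $|P_iR_i|=2m+2i$.
   Context: For $i\ge0$, $P_i$ (resp. $R_i$) is the poset obtained by placing $P_0$ (resp. $R_0$) above a chain of $i$ elements (every element of $P_0$ above every chain element), and $P_iR_i$ is the disjoint union of $P_i$ and $R_i$. A downset is a downward-closed subset; $D_n(Q)$ is the set of downsets of $Q$ of size $n$ up to isomorphism. A poset $Q$ is a witness of a set $\Gamma_n$ of unlabelled posets of size $n$ if $D_n(Q)=\Gamma_n$. *)

(* Defs.v *)
From mathcomp Require Import all_boot.
Set Implicit Arguments. Unset Strict Implicit. Unset Printing Implicit Defensive.

Definition is_poset (T : finType) (le : rel T) : Prop :=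
  [/\ reflexive le, antisymmetric le & transitive le].

Definition is_downset (T : finType) (le : rel T) (S : {set T}) : Prop :=
  forall x y, y \in S -> le x y -> x \in S.

Definition sub_iso (T T' : finType) (le : rel T) (le' : rel T')
  (S : {set T}) (S' : {set T'}) : Prop :=
  exists f : T -> T',
    [/\ {in S &, injective f}, f @: S = S' &
        {in S &, forall x y, le' (f x) (f y) = le x y}].

Definition poset_iso (T T' : finType) (le : rel T) (le' : rel T') : Prop :=
  sub_iso le le' [set: T] [set: T'].

(* D_n(T) = D_n(T') as sets of isomorphism classes of downsets of size n *)
Definition same_Dn (n : nat) (T T' : finType) (le : rel T) (le' : rel T') : Prop :=
  (forall S : {set T}, is_downset le S -> #|S| = n ->
     exists2 S' : {set T'}, is_downset le' S' /\ #|S'| = n & sub_iso le le' S S') /\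
  (forall S' : {set T'}, is_downset le' S' -> #|S'| = n ->
     exists2 S : {set T}, is_downset le S /\ #|S| = n & sub_iso le le' S S').

(* P_i: P_0 placed above a chain of i elements (chain = 'I_i with <=). *)
Definition above_chain_le (T : finType) (le : rel T) (i : nat) : rel (T + 'I_i) :=
  fun x y => match x, y with
  | inl a, inl b => le a b
  | inr j, inr k => (j <= k)%N
  | inr _, inl _ => true
  | inl _, inr _ => false
  end.

Definition dunion_le (T U : finType) (leT : rel T) (leU : rel U) : rel (T + U) :=
  fun x y => match x, y with
  | inl a, inl b => leT a b
  | inr a, inr b => leU a b
  | _, _ => false
  end.

Arguments above_chain_le T le i : clear implicits.
Definition PiRi_le (T U : finType) (leP : rel T) (leR : rel U) (i : nat)
  : rel ((T + 'I_i) + (U + 'I_i)) :=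
  @dunion_le _ _ (@above_chain_le T leP i) (@above_chain_le U leR i).
Arguments PiRi_le T U leP leR i : clear implicits.

(* Main.v *)
(* The downset of P_i R_i consisting of P_i and the bottom of the R-chain has
   size i+m+1, so a witness Q contains a copy C_P of P_i as a downset, and
   likewise a copy C_R of R_i.  If C_P and C_R are disjoint, |Q| >= 2m+2i.
   If C_R is contained in C_P they coincide (same size), so P_i ~ R_i, and
   P_0 ~ R_0 follows because an isomorphism must send the elements having more
   than i elements below them (those of P_0) to those of R_0.  Otherwise both
   copies have least elements and share an element, so adding to C_P a minimal
   element of C_R \ C_P gives a downset of Q of size i+m+1 with a least
   element; its counterpart in P_i R_i would lie in one component, which has
   only m+i elements. *)
Require Import Defs.
From mathcomp Require Import all_boot zify.
Set Implicit Arguments. Unset Strict Implicit. Unset Printing Implicit Defensive.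

Definition has_least (T : finType) (le : rel T) (S : {set T}) : Prop :=
  exists2 r, r \in S & {in S, forall x, le r x}.

Definition is_inl (A B : Type) (w : A + B) : bool := if w is inl _ then true else false.

Definition downsets_realized (Q W : finType) (leQ : rel Q) (leW : rel W) (n : nat) : Prop :=
  forall S' : {set W}, is_downset leW S' -> #|S'| = n ->
    exists2 S : {set Q}, is_downset leQ S /\ #|S| = n & sub_iso leQ leW S S'.

Section SubIso.

Variables (T T' : finType) (le : rel T) (le' : rel T').

Lemma sub_iso_card (S : {set T}) (S' : {set T'}) : sub_iso le le' S S' -> #|S| = #|S'|.
Proof. by case=> f [finj <- _]; rewrite card_in_imset. Qed.

Lemma sub_iso_card_below (S : {set T}) (f : T -> T') :
  {in S &, injective f} -> {in S &, forall x y, le' (f x) (f y) = le x y} ->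
  {in S, forall x, #|[set y in S | le y x]| = #|[set w in f @: S | le' w (f x)]|}.
Proof.
move=> finj fmono x xS.
have -> : [set w in f @: S | le' w (f x)] = f @: [set y in S | le y x].
  apply/setP => w; rewrite !inE; apply/andP/imsetP.
    by case=> /imsetP[y yS ->] lyx; exists y; rewrite // inE yS -fmono.
  by case=> y; rewrite inE => /andP[yS lyx] ->; rewrite imset_f // fmono.
by rewrite card_in_imset // => y z; rewrite !inE => /andP[yS _] /andP[zS _]; apply: finj.
Qed.

Lemma sub_iso_has_least (S : {set T}) (S' : {set T'}) :
  sub_iso le le' S S' -> has_least le S <-> has_least le' S'.
Proof.
case=> f [_ <- fmono]; split.
  case=> r rS rmin; exists (f r); first exact: imset_f.
  by move=> _ /imsetP[x xS ->]; rewrite fmono ?rmin.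
case=> _ /imsetP[r rS ->] rmin; exists r => // x xS.
by rewrite -fmono ?rmin ?imset_f.
Qed.

Lemma sub_iso_restrict (S : {set T}) (S' S'' : {set T'}) :
  is_downset le S -> is_downset le' S'' -> S'' \subset S' ->
  sub_iso le le' S S' -> exists2 C, is_downset le C & sub_iso le le' C S''.
Proof.
move=> dS dS'' sub'' [f [finj fS fmono]].
have CS : {subset [set x in S | f x \in S''] <= S} by move=> x; rewrite inE => /andP[].
exists [set x in S | f x \in S''].
  move=> x y; rewrite !inE => /andP[yS fyS''] lxy; have xS := dS x y yS lxy.
  by rewrite xS (dS'' _ (f y)) // fmono.
exists f; split; [exact: sub_in2 finj | | exact: sub_in2 fmono].
apply/setP => w; apply/imsetP/idP => [[x] | wS''].
  by rewrite inE => /andP[_ ?] ->.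
have /imsetP[x xS wE] : w \in f @: S by rewrite fS (subsetP sub'').
by exists x; rewrite // inE xS -wE.
Qed.

End SubIso.

Lemma sub_iso_transfer (T T' : finType) (le : rel T) (le' le'' : rel T')
    (C : {set T}) (S' S'' : {set T'}) :
  sub_iso le le' C S' -> sub_iso le le'' C S'' -> sub_iso le' le'' S' S''.
Proof.
case=> f [finj <- fmono] [g [ginj <- gmono]].
pose h y := if [pick x in C | f x == y] is Some x then g x else y.
have hE : {in C, forall x, h (f x) = g x}.
  move=> x xC; rewrite /h; case: pickP => [x' /andP[x'C /eqP fx'] | /(_ x)].
    by rewrite (finj x' x).
  by rewrite xC eqxx.
exists h; split.
- by move=> _ _ /imsetP[x xC ->] /imsetP[y yC ->]; rewrite !hE // => /ginj ->.
- by rewrite -imset_comp; apply: eq_in_imset => x xC; rewrite /= hE.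
- by move=> _ _ /imsetP[x xC ->] /imsetP[y yC ->]; rewrite !hE // gmono // fmono.
Qed.

Section Downsets.

Variables (Q : finType) (le : rel Q).

Lemma is_downsetU (A B : {set Q}) :
  is_downset le A -> is_downset le B -> is_downset le (A :|: B).
Proof.
move=> dA dB x y; rewrite !inE => /orP[yA | yB] lxy.
  by rewrite (dA x y yA lxy).
by rewrite (dB x y yB lxy) orbT.
Qed.

Lemma is_downset_set1 (b : Q) :
  (forall y, le y b -> y = b) -> is_downset le [set b].
Proof. by move=> bmin x y; rewrite !inE => /eqP -> /bmin ->. Qed.

Hypothesis le_poset : is_poset le.

(* A point with the fewest elements below it is minimal. *)
Lemma exists_minimal (X : {set Q}) x0 :
  x0 \in X -> exists2 z, z \in X & forall y, y \in X -> le y z -> y = z.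
Proof.
case: le_poset => refl anti trans x0X.
case: (arg_minnP (fun z => #|[set y | le y z]|) x0X) => z zX zmin.
exists z => // y yX lyz.
have sub : [set t | le t y] \subset [set t | le t z].
  by apply/subsetP => t; rewrite !inE => lty; apply: trans lty lyz.
have : [set t | le t y] == [set t | le t z] by rewrite eqEcard sub zmin.
move/eqP/setP/(_ z); rewrite !inE refl => lzy.
by apply: anti; rewrite lyz lzy.
Qed.

Lemma downset_extend_least (C1 C2 : {set Q}) :
  is_downset le C1 -> is_downset le C2 -> has_least le C1 -> has_least le C2 ->
  ~~ [disjoint C1 & C2] -> ~~ (C2 \subset C1) ->
  exists2 D, is_downset le D /\ #|D| = #|C1|.+1 & has_least le D.
Proof.
move=> dC1 dC2 [r rC1 rmin] [s sC2 smin].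
rewrite -setI_eq0 => /set0Pn[w]; rewrite inE => /andP[wC1 wC2].
case/subsetPn => z0 z0C2 z0C1.
have sC1 : s \in C1 := dC1 s w wC1 (smin w wC2).
have [|z] := @exists_minimal (C2 :\: C1) z0; first by rewrite inE z0C1.
rewrite inE => /andP[zC1 zC2] zmin.
exists (z |: C1); last first.
  exists r => [|x]; first by rewrite in_setU1 rC1 orbT.
  rewrite in_setU1 => /orP[/eqP -> | /rmin //].
  by case: le_poset => _ _ trans; apply: trans (rmin s sC1) (smin z zC2).
split; last by rewrite cardsU1 zC1.
move=> x y; rewrite !in_setU1 => /orP[/eqP -> lxz | yC1 lxy]; last first.
  by rewrite (dC1 x y yC1 lxy) orbT.
have [xC1 | xC1] := boolP (x \in C1); first by rewrite orbT.
by rewrite orbF (zmin x) // inE xC1 (dC2 x z zC2 lxz).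
Qed.

End Downsets.

Section DisjointUnion.

Variables (A B : finType) (leA : rel A) (leB : rel B).
Local Notation le := (dunion_le leA leB).

Lemma dunion_le_is_inl x y : le x y -> is_inl x = is_inl y.
Proof. by case: x => ?; case: y. Qed.

Lemma is_downset_inl : is_downset le [set w | is_inl w].
Proof. by move=> x y; rewrite !inE => yl /dunion_le_is_inl ->. Qed.

Lemma is_downset_inr : is_downset le [set w | ~~ is_inl w].
Proof. by move=> x y; rewrite !inE => yr /dunion_le_is_inl ->. Qed.

Lemma card_inl_set : #|[set w : A + B | is_inl w]| = #|A|.
Proof.
have -> : [set w : A + B | is_inl w] = inl @: [set: A].
  by apply/setP => -[a|b]; rewrite !inE /= ?imset_f //; apply/esym/imsetP => -[].
by rewrite card_imset ?cardsT // => ? ? [].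
Qed.

Lemma card_inr_set : #|[set w : A + B | ~~ is_inl w]| = #|B|.
Proof.
have -> : [set w : A + B | ~~ is_inl w] = inr @: [set: B].
  by apply/setP => -[a|b]; rewrite !inE /= ?imset_f //; apply/esym/imsetP => -[].
by rewrite card_imset ?cardsT // => ? ? [].
Qed.

Lemma dunion_least_card (S : {set A + B}) : has_least le S -> #|S| <= maxn #|A| #|B|.
Proof.
case=> r _ rmin; case rl: (is_inl r).
  rewrite -card_inl_set (leq_trans _ (leq_maxl _ _)) //.
  by apply/subset_leq_card/subsetP => x /rmin /dunion_le_is_inl; rewrite inE rl => <-.
rewrite -card_inr_set (leq_trans _ (leq_maxr _ _)) //.
by apply/subset_leq_card/subsetP => x /rmin /dunion_le_is_inl; rewrite inE rl => <-.
Qed.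

Lemma dunion_has_least_inl a :
  (forall y, leA a y) -> has_least le [set w | is_inl w].
Proof. by move=> amin; exists (inl a) => [|[y|y]]; rewrite inE //= => _; apply: amin. Qed.

Lemma dunion_has_least_inr b :
  (forall y, leB b y) -> has_least le [set w | ~~ is_inl w].
Proof. by move=> bmin; exists (inr b) => [|[y|y]]; rewrite inE //= => _; apply: bmin. Qed.

Lemma dunion_minimal_inl a :
  (forall y, leA y a -> y = a) -> forall y, le y (inl a) -> y = inl a.
Proof. by move=> amin [y /amin -> |]. Qed.

Lemma dunion_minimal_inr b :
  (forall y, leB y b -> y = b) -> forall y, le y (inr b) -> y = inr b.
Proof. by move=> bmin [|y /bmin ->]. Qed.

End DisjointUnion.

Section AboveChain.

Variables (T : finType) (le : rel T) (i : nat) (j : 'I_i).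
Hypothesis j_eq0 : j = 0 :> nat.

Lemma above_chain_bottom_least y : above_chain_le T le i (inr j) y.
Proof. by case: y => //= k; rewrite j_eq0. Qed.

Lemma above_chain_bottom_minimal y : above_chain_le T le i y (inr j) -> y = inr j.
Proof.
case: y => //= k; rewrite j_eq0 leqn0 => /eqP k0.
by congr inr; apply: val_inj; rewrite /= k0 j_eq0.
Qed.

End AboveChain.

Section PiRi.

Variables (T U : finType) (leP : rel T) (leR : rel U) (i : nat).
Local Notation W := (PiRi_le T U leP leR i).

Lemma PiRi_card_below_top a : reflexive leP ->
  i < #|[set w in [set w | is_inl w] | W w (inl (inl a))]|.
Proof.
move=> reflP; apply: (@leq_trans #|inl (inl a) |: [set inl (inr k) | k : 'I_i]|).
  rewrite cardsU1 card_imset; last by move=> k1 k2 [].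
  by rewrite card_ord; case: imsetP => // -[k _].
apply/subset_leq_card/subsetP => w; rewrite !inE.
by case/orP => [/eqP -> /= | /imsetP[k _ ->] //]; apply: reflP.
Qed.

Lemma PiRi_card_below_chain (j : 'I_i) :
  #|[set w in [set w | ~~ is_inl w] | W w (inr (inr j))]| <= i.
Proof.
apply: (@leq_trans #|[set inr (inr k) | k : 'I_i]|).
  apply/subset_leq_card/subsetP => -[w | [w | k]]; rewrite !inE //= => _.
  exact: imset_f.
by rewrite (leq_trans (leq_imset_card _ _)) ?card_ord.
Qed.

Lemma PiRi_sides_iso : reflexive leP -> #|T| = #|U| ->
  sub_iso W W [set w | is_inl w] [set w | ~~ is_inl w] -> poset_iso leP leR.
Proof.
move=> reflP cTU [h [hinj hL hmono]].
have top a : exists u, h (inl (inl a)) == inr (inl u).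
  have aL : inl (inl a) \in [set w : (T + 'I_i) + (U + 'I_i) | is_inl w] by rewrite inE.
  have := imset_f h aL; rewrite hL inE.
  case hE: (h _) => [// | [u | k]] _; first by exists u.
  have := sub_iso_card_below hinj hmono aL; rewrite hL hE => below.
  by have := PiRi_card_below_top a reflP; rewrite below ltnNge PiRi_card_below_chain.
pose phi a := xchoose (top a).
have phiE a : h (inl (inl a)) = inr (inl (phi a)) by apply/eqP/(xchooseP (top a)).
have phi_mono a b : leR (phi a) (phi b) = leP a b.
  by have := hmono (inl (inl a)) (inl (inl b)); rewrite !phiE !inE => /(_ isT isT).
have phi_inj : injective phi.
  move=> a b eab; have := hinj (inl (inl a)) (inl (inl b)).
  by rewrite !phiE eab !inE => /(_ isT isT erefl) [].
exists phi; split => [a b _ _ | | a b _ _]; [exact: phi_inj | | exact: phi_mono].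
by apply/eqP; rewrite eqEcard subsetT card_imset // !cardsT cTU leqnn.
Qed.

Lemma PiRi_inl_copy (Q : finType) (leQ : rel Q) (n : nat) :
  0 < i -> n = #|T| + i + 1 -> downsets_realized leQ W n ->
  exists2 C, is_downset leQ C & sub_iso leQ W C [set w | is_inl w] /\ has_least leQ C.
Proof.
move=> i_gt0 -> realize; pose j0 : 'I_i := Ordinal i_gt0.
have dS : is_downset W (inr (inr j0) |: [set w | is_inl w]).
  apply/is_downsetU/is_downset_inl/is_downset_set1/dunion_minimal_inr.
  exact: (@above_chain_bottom_minimal _ _ _ j0 erefl).
have [|S [dS' _] isoS] := realize _ dS.
  by rewrite cardsU1 inE /= card_inl_set card_sum card_ord add1n addn1.
have [C dC isoC] := sub_iso_restrict dS' (@is_downset_inl _ _ _ _) (subsetUr _ _) isoS.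
exists C => //; split => //; apply/(sub_iso_has_least isoC)/dunion_has_least_inl.
exact: (@above_chain_bottom_least _ _ _ j0 erefl).
Qed.

Lemma PiRi_inr_copy (Q : finType) (leQ : rel Q) (n : nat) :
  0 < i -> n = #|U| + i + 1 -> downsets_realized leQ W n ->
  exists2 C, is_downset leQ C & sub_iso leQ W C [set w | ~~ is_inl w] /\ has_least leQ C.
Proof.
move=> i_gt0 -> realize; pose j0 : 'I_i := Ordinal i_gt0.
have dS : is_downset W (inl (inr j0) |: [set w | ~~ is_inl w]).
  apply/is_downsetU/is_downset_inr/is_downset_set1/dunion_minimal_inl.
  exact: (@above_chain_bottom_minimal _ _ _ j0 erefl).
have [|S [dS' _] isoS] := realize _ dS.
  by rewrite cardsU1 inE /= card_inr_set card_sum card_ord add1n addn1.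
have [C dC isoC] := sub_iso_restrict dS' (@is_downset_inr _ _ _ _) (subsetUr _ _) isoS.
exists C => //; split => //; apply/(sub_iso_has_least isoC)/dunion_has_least_inr.
exact: (@above_chain_bottom_least _ _ _ j0 erefl).
Qed.

End PiRi.

Theorem mainTheorem5 (m i : nat) (T U : finType) (leP : rel T) (leR : rel U) :
  is_poset leP -> is_poset leR -> #|T| = m -> #|U| = m ->
  ~ poset_iso leP leR -> (1 <= i)%N ->
  forall (Q : finType) (leQ : rel Q), is_poset leQ ->
    same_Dn (i + m + 1) leQ (PiRi_le T U leP leR i) ->
    (2 * m + 2 * i <= #|Q|)%N.
Proof.
move=> [reflP _ _] _ cT cU niso i_gt0 Q leQ posQ [realizeQ realizeW].
have [|CP dCP [isoP leastP]] := PiRi_inl_copy i_gt0 _ realizeW; first by rewrite cT; lia.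
have [|CR dCR [isoR leastR]] := PiRi_inr_copy i_gt0 _ realizeW; first by rewrite cU; lia.
have cCP : #|CP| = m + i by rewrite (sub_iso_card isoP) card_inl_set card_sum cT card_ord.
have cCR : #|CR| = m + i by rewrite (sub_iso_card isoR) card_inr_set card_sum cU card_ord.
have [disj | meet] := boolP [disjoint CP & CR].
  move: disj (max_card (mem (CP :|: CR))); rewrite -setI_eq0 cardsU => /eqP ->.
  by rewrite cards0 cCP cCR; lia.
have not_sub : ~~ (CR \subset CP).
  apply: contra_notN niso => sub; apply: PiRi_sides_iso reflP (etrans cT (esym cU)) _.
  have eCR : CR = CP by apply/eqP; rewrite eqEcard sub cCP cCR leqnn.
  by apply: sub_iso_transfer isoP _; rewrite -eCR.
have [D [dD cD] leastD] := downset_extend_least posQ dCP dCR leastP leastR meet not_sub.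
have [D' [_ cD'] isoD] := realizeQ D dD ltac:(rewrite cD cCP; lia).
have := dunion_least_card ((sub_iso_has_least isoD).1 leastD).
by rewrite cD' !card_sum cT cU card_ord maxnn; lia.
Qed.
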